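(* Let $G$ be a finite group and let $K:=\mathbb{Q}(G)$. Then every prime divisor of $|\mathbb{Z}_K/\mathbb{Z}[G]|$ divides $|G|$.
   Context: For a finite group $G$, $\operatorname{Irr}(G)$ denotes the set of irreducible complex characters of $G$. $\mathbb{Q}(G):=\mathbb{Q}(\chi(g):\chi\in\operatorname{Irr}(G),\ g\in G)\subseteq\mathbb{C}$ is the number field generated by all character values of $G$. $\mathbb{Z}_K$ is the ring of integers of a number field $K$. $\mathbb{Z}[G]$ denotes the subring of $\mathbb{C}$ generated by all the character values $\chi(g)$ with $\chi\in\operatorname{Irr}(G)$, $g\in G$ (it is neither the group algebra nor the ring of generalized characters). It is an order contained in $\mathbb{Z}_{\mathbb{Q}(G)}$, so $\mathbb{Z}_{\mathbb{Q}(G)}/\mathbb{Z}[G]$ is a finite abelian group. *)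

(* Defs.v *)
From HB Require Import structures.
From mathcomp Require Import all_boot all_order all_fingroup all_algebra.
From mathcomp Require Import all_solvable all_field all_character.
From mathcomp Require Import finmap boolp classical_sets cardinality.

Set Implicit Arguments.
Unset Strict Implicit.
Unset Printing Implicit Defensive.

Import GRing.Theory Num.Theory.
Local Open Scope classical_set_scope.
Local Open Scope ring_scope.

(* The irreducible complex characters of a finite group take values in the
   algebraic numbers, so C is replaced by its subfield [algC], as throughout
   the character theory of the library. *)

Definition char_values (gT : finGroupType) (G : {group gT}) : set algC :=
  [set x | exists (i : Iirr G) (g : gT), g \in G /\ x = 'chi_i g].

(* [divring_closed] is closure under 1, subtraction and division; in a field,
   where x / 0 = 0, this characterizes subfields. *)
Definition gen_subfield (X : set algC) : {pred algC} :=
  [pred x | x \in smallest (fun A : set algC => divring_closed [in A]) X].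

Definition gen_subring (X : set algC) : {pred algC} :=
  [pred x | x \in smallest (fun A : set algC => subring_closed [in A]) X].

Section GeneratedClosed.
Variable X : set algC.

Fact gen_subfield_closed : divring_closed (gen_subfield X).
Proof.
split=> [|x y|x y]; rewrite !inE.
- by move=> A [[A1 _ _] _]; apply: set_mem.
- move=> Kx Ky A KA; case: (KA) => -[_ AB _] _.
  by apply: set_mem; apply: AB; apply: mem_set; [apply: Kx | apply: Ky].
move=> Kx Ky A KA; case: (KA) => -[_ _ AD] _.
by apply: set_mem; apply: AD; apply: mem_set; [apply: Kx | apply: Ky].
Qed.

Fact gen_subring_closed : subring_closed (gen_subring X).
Proof.
split=> [|x y|x y]; rewrite !inE.
- by move=> A [[A1 _ _] _]; apply: set_mem.
- move=> Kx Ky A KA; case: (KA) => -[_ AB _] _.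
  by apply: set_mem; apply: AB; apply: mem_set; [apply: Kx | apply: Ky].
move=> Kx Ky A KA; case: (KA) => -[_ _ AM] _.
by apply: set_mem; apply: AM; apply: mem_set; [apply: Kx | apply: Ky].
Qed.

HB.instance Definition _ :=
  GRing.isDivringClosed.Build algC (gen_subfield X) gen_subfield_closed.
HB.instance Definition _ :=
  GRing.isSubringClosed.Build algC (gen_subring X) gen_subring_closed.

Lemma mem_gen_subfield x : X x -> x \in gen_subfield X.
Proof. by move=> Xx; rewrite inE; apply: sub_gen_smallest. Qed.

Lemma mem_gen_subring x : X x -> x \in gen_subring X.
Proof. by move=> Xx; rewrite inE; apply: sub_gen_smallest. Qed.

End GeneratedClosed.

Section RingOfIntegers.
Variable K : divringClosed algC.

Definition in_integers : {pred algC} := [pred x | (x \in Aint) && (x \in K)].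

Fact in_integers_closed : subring_closed in_integers.
Proof.
split=> [|x y|x y]; rewrite !inE ?rpred1 //.
- by case/andP=> Ax Kx /andP[Ay Ky]; rewrite !rpredB.
by case/andP=> Ax Kx /andP[Ay Ky]; rewrite !rpredM.
Qed.

HB.instance Definition _ :=
  GRing.isSubringClosed.Build algC in_integers in_integers_closed.

Definition alg_integers := {x : algC | x \in in_integers}.

HB.instance Definition _ := SubChoice.on alg_integers.
HB.instance Definition _ := [SubChoice_isSubComNzRing of alg_integers by <:].

End RingOfIntegers.

Section CharacterRing.
Variables (gT : finGroupType) (G : {group gT}).

Definition char_field : {pred algC} := gen_subfield (char_values G).
HB.instance Definition _ := GRing.DivringClosed.on char_field.

Definition char_ring : {pred algC} := gen_subring (char_values G).
HB.instance Definition _ := GRing.SubringClosed.on char_ring.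

Lemma char_ring_integers : {subset char_ring <= in_integers char_field}.
Proof.
move=> x; rewrite inE => Rx.
apply: (Rx [set` in_integers char_field]); split.
  have [I1 IB IM] := in_integers_closed char_field.
  by split=> [|y z|y z]; rewrite !mem_setE; [exact: I1 | exact: IB | exact: IM].
move=> y [i [g [Gg ->]]] /=; rewrite inE Aint_irr /=.
by apply: mem_gen_subfield; exists i, g.
Qed.

Definition char_ring_in_integers : {pred alg_integers char_field} :=
  [pred x | val x \in char_ring].

Fact char_ring_in_integers_closed : zmod_closed char_ring_in_integers.
Proof.
split=> [|x y Rx Ry].
  by rewrite -[_ \in _]/(\val (0 : alg_integers char_field) \in char_ring)
    rmorph0 rpred0.
by rewrite -[_ \in _]/(\val (x - y) \in char_ring) rmorphB rpredB.
Qed.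

HB.instance Definition _ :=
  GRing.isZmodClosed.Build (alg_integers char_field) char_ring_in_integers
    char_ring_in_integers_closed.

(* As sets of algebraic numbers, [char_ring] is contained in the ring of
   integers ([char_ring_integers]), so the pullback [char_ring_in_integers] is
   all of [char_ring].  [Quotient.quot] is the quotient additive group. *)
Definition integers_mod_char_ring := Quotient.quot char_ring_in_integers.

(* [fset_set] sends an infinite set to the empty one, so this is 0 when the
   quotient is infinite. *)
Definition char_ring_index : nat :=
  #|` fset_set [set: integers_mod_char_ring]|%fset.

End CharacterRing.

(* Main.v *)
Require Import Defs.
From HB Require Import structures.
From mathcomp Require Import all_boot all_order all_fingroup all_algebra.
From mathcomp Require Import all_solvable all_field all_character.
From mathcomp Require Import finmap boolp classical_sets cardinality.

(* Let Gamma = Gal(K/Q).  It permutes Irr(G) faithfully, so by orthogonality the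
   sum over g of chi^s(g) chi(g^-1), for s in Gamma, is |G| if s fixes chi and 0
   otherwise.  Multiplying these sums over the h characters chi gives products
   a_f, b_f of character values such that the sum over f of s(a_f) b_f is |G|^h
   if s = 1 and 0 otherwise.  Hence, for x in K,
     |G|^h x = sum over f of Tr(x a_f) b_f.
   On Z_K the traces are integers, so x lies in Z[G] as soon as they are all
   divisible by |G|^h: Z_K / Z[G] is a quotient of a subgroup of some
   (Z / |G|^h)^F. *)

Set Implicit Arguments.
Unset Strict Implicit.
Unset Printing Implicit Defensive.

Import GRing.Theory Num.Theory.
Local Open Scope ring_scope.

(** * Counting a quotient through an additive map *)

(** As ker c lies in S, c induces a bijection from X/S onto the cosets of c(S) in c(X), whose number
    divides |c(X)|, hence |V|. *)
Lemma dvdn_card_quot (X : zmodType) (S : zmodClosed X) (V : finZmodType)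
    (c : {additive X -> V}) :
    (forall x, c x = 0 -> x \in S) ->
  (#|` fset_set [set: Quotient.quot S]%classic|%fset %| #|V|)%N.
Proof.
move=> kerS.
pose imc (P : {pred X}) : {set V} :=
  [set v | `[< exists2 x, x \in P & c x = v >]].
have imcP (P : {pred X}) v :
    reflect (exists2 x, x \in P & c x = v) (v \in imc P).
  by rewrite inE; apply: asboolP.
have imc_group (P : {pred X}) : 0 \in P ->
    (forall x y, x \in P -> y \in P -> x + y \in P) ->
  group_set (imc P).
  move=> P0 PD; apply/group_setP; split.
    by apply/imcP; exists 0; rewrite ?raddf0.
  move=> _ _ /imcP[x Px <-] /imcP[y Py <-]; apply/imcP; exists (x + y).
    exact: PD.
  by rewrite raddfD.
pose A := Group (imc_group predT isT (fun _ _ _ _ => isT)).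
have [S0 SD] : 0 \in S /\ forall x y, x \in S -> y \in S -> x + y \in S.
  by split=> [|x y]; [exact: rpred0 | exact: rpredD].
pose B := Group (imc_group (mem S) S0 SD).
have memA x : c x \in A by apply/imcP; exists x.
have memB x : (c x \in B) = (x \in S).
  apply/imcP/idP => [[y Sy eq_c]|Sx]; last by exists x.
  by rewrite -[x](subrK y) rpredD // kerS // raddfB /= eq_c subrr.
have eq_coset x y : (B :* c x = B :* c y)%g <-> x - y \in S.
  rewrite -memB raddfB /= -[c x - c y]/(c x * (c y)^-1)%g -mem_rcoset.
  by split=> /(rcoset_eqP (G := B)).
pose f (q : Quotient.quot S) := (B :* c (generic_quotient.repr q))%g.
have f_inj : injective f.
  move=> q r eq_f.
  have : generic_quotient.repr q - generic_quotient.repr r \in S.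
    exact/eq_coset.
  by rewrite Quotient.idealrBE => /eqP; rewrite !reprK.
have im_f : (f @` [set: _] = [set` [fset C in rcosets B A]%fset])%classic.
  apply/seteqP; split=> C /=; rewrite !inE.
    by move=> [q _ <-]; apply/rcosetsP; exists (c (generic_quotient.repr q)).
  case/rcosetsP=> _ /imcP[x _ <-] ->; exists (\pi x)%qT => //.
  by apply/eq_coset; rewrite Quotient.idealrBE reprK.
(* Without finiteness, [fset_set] would be empty and the count a meaningless 0. *)
have fin_quot : finite_set [set: Quotient.quot S].
  rewrite -(preimage_setT f); apply: finite_preimage; last exact: finite_finset.
  by move=> q r _ _; exact: f_inj.
have -> : #|` fset_set [set: Quotient.quot S]%classic|%fset = #|rcosets B A|.
  transitivity (#|` fset_set (f @` [set: _])%classic|)%fset.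
    by rewrite fset_set_image // card_imfset.
  by rewrite im_f set_fsetK card_imfset //= cardE.
apply: dvdn_trans (dvdn_indexg A B) _; rewrite -cardsT.
exact: cardSg (finset.subsetT A).
Qed.

(** * The Galois action on the irreducible characters *)

Section CharField.
Variables (gT : finGroupType) (G : {group gT}).
Implicit Types (i : Iirr G) (u v : {rmorphism algC -> algC}).

Lemma irr_char_ring i g : 'chi_i g \in char_ring G.
Proof.
have [Gg|/cfun0->] := boolP (g \in G); last exact: rpred0.
by apply: mem_gen_subring; exists i, g.
Qed.

Lemma char_ring_field x : x \in char_ring G -> x \in char_field G.
Proof. by move/char_ring_integers/andP=> []. Qed.

Lemma aut_irrE u i g : u ('chi_i g) = 'chi_(aut_Iirr u i) g.
Proof. by rewrite aut_IirrE cfunE. Qed.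

Lemma char_field_ind (A : set algC) : divring_closed [in A] ->
    (forall i g, g \in G -> A ('chi_i g)) ->
  forall x, x \in char_field G -> A x.
Proof.
move=> Acl Achi x; rewrite inE; apply: smallest_sub => // _ [i [g [Gg ->]]].
exact: Achi.
Qed.

(** The character values lie in a Galois extension Qn of Q whose automorphisms extend to [algC], so
    x comes from the fixed field, which is Q. *)
Lemma char_field_fixed_rat x :
  x \in char_field G -> (forall u, u x = x) -> x \in Crat.
Proof.
have [Qn galQn [QnC gQnC [_ _ Qn_g]]] := group_num_field_exists G.
move=> Kx fix_x.
have [y Dx] : exists y, QnC y = x.
  apply: (char_field_ind (A := fun x => exists y, QnC y = x)) Kx => [|i g Gg].
    split=> [|_ _ /set_mem[y <-] /set_mem[z <-]
             |_ _ /set_mem[y <-] /set_mem[z <-]]; apply/mem_set.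
    - by exists 1; rewrite rmorph1.
    - by exists (y - z); rewrite rmorphB.
    - by exists (y / z); rewrite fmorph_div.
  by have [y] := Qn_g _ G _ (irr_char i) g (order_dvdG Gg); exists y.
have : y \in fixedField 'Gal({:Qn} / 1)%g.
  apply/fixedFieldP=> [|nu Gnu]; first exact: memvf.
  have [u Du] := gQnC nu.
  by apply: (fmorph_inj QnC); rewrite Du Dx.
rewrite (galois_fixedField galQn) => /vlineP[a Dy].
by rewrite -Dx Dy rmorphZ_num rmorph1 mulr1 Crat_rat.
Qed.

Definition irr_action u : {ffun Iirr G -> Iirr G} := [ffun i => aut_Iirr u i].

(* The image of Gamma in the permutations of Irr(G); it stands for Gamma. *)
Definition galois_actions : {set {ffun Iirr G -> Iirr G}} :=
  [set s | `[< exists u, irr_action u = s >]].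

Definition galois_lift (s : {ffun Iirr G -> Iirr G}) :
    {rmorphism algC -> algC} :=
  if pselect (exists u, irr_action u = s) is left ex_u then sval (cid ex_u)
  else idfun.

Lemma mem_galois_actions u : irr_action u \in galois_actions.
Proof. by rewrite inE; apply/asboolP; exists u. Qed.

Lemma galois_liftK s :
  s \in galois_actions -> irr_action (galois_lift s) = s.
Proof.
rewrite inE /galois_lift => /asboolP ex_u.
by case: pselect => // ex_u'; case: cid.
Qed.

(** The action on Irr(G) determines all u(chi(g)), and these values generate K. Hence on K the
    choice made in [galois_lift] is immaterial. *)
Lemma eq_irr_action u v x :
  irr_action u = irr_action v -> x \in char_field G -> u x = v x.
Proof.
move=> eq_uv; apply: (char_field_ind (A := fun x => u x = v x)) => [|i g Gg].
  split=> [|y z /set_mem eqy /set_mem eqz|y z /set_mem eqy /set_mem eqz];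
      apply/mem_set.
  - by rewrite !rmorph1.
  - by rewrite !rmorphB eqy eqz.
  - by rewrite !fmorph_div eqy eqz.
have /ffunP/(_ i) := eq_uv; rewrite !ffunE => eq_i.
by rewrite !aut_irrE eq_i.
Qed.

Lemma char_field_aut u x : x \in char_field G -> u x \in char_field G.
Proof.
apply: (char_field_ind (A := fun x => u x \in char_field G)) => [|i g Gg].
  split=> [|y z /set_mem Ky /set_mem Kz|y z /set_mem Ky /set_mem Kz];
      apply/mem_set.
  - by rewrite rmorph1 rpred1.
  - by rewrite rmorphB rpredB.
  - by rewrite fmorph_div rpred_div.
by rewrite aut_irrE char_ring_field ?irr_char_ring.
Qed.

(** * The trace from K to Q; outside K it depends on the chosen lifts *)

Definition char_trace x : algC := \sum_(s in galois_actions) galois_lift s x.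

Lemma char_trace_is_additive : zmod_morphism char_trace.
Proof.
by move=> x y; rewrite -sumrB; apply: eq_bigr => s _; rewrite rmorphB.
Qed.

HB.instance Definition _ :=
  GRing.isZmodMorphism.Build algC algC char_trace char_trace_is_additive.

(** Composition with u permutes [galois_actions], so it only reindexes the sum. *)
Lemma char_trace_aut u x :
  x \in char_field G -> u (char_trace x) = char_trace x.
Proof.
move=> Kx.
pose act (s : {ffun Iirr G -> Iirr G}) := [ffun i => aut_Iirr u (s i)].
have act_comp v : irr_action (u \o v) = act (irr_action v).
  apply/ffunP=> i; rewrite !ffunE; apply: irr_inj; apply/cfunP=> g.
  by rewrite !aut_IirrE !cfunE.
have act_inj : injective act.
  move=> s t /ffunP eq_st; apply/ffunP=> i; have := eq_st i; rewrite !ffunE.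
  exact: aut_Iirr_inj.
(* An injective map of a finite set into itself is onto. *)
have act_gal : act @: galois_actions = galois_actions.
  apply/eqP; rewrite eqEcard card_imset // leqnn andbT.
  apply/fintype.subsetP=> _ /imsetP[s gal_s ->].
  by rewrite -(galois_liftK gal_s) -act_comp mem_galois_actions.
rewrite /char_trace -[in RHS]act_gal big_imset /=; last first.
  by move=> ? ? _ _ /act_inj.
rewrite rmorph_sum; apply: eq_bigr => s gal_s.
apply: (@eq_irr_action (u \o galois_lift s)) => //.
rewrite act_comp !galois_liftK // -act_gal; exact: imset_f.
Qed.

Lemma char_trace_int x :
  x \in in_integers (char_field G) -> char_trace x \in Num.int.
Proof.
case/andP=> Ax Kx; apply: Cint_rat_Aint; last first.
  by apply: rpred_sum => s _; rewrite Aint_aut.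
apply: char_field_fixed_rat => [|u]; last exact: char_trace_aut.
by apply: rpred_sum => s _; exact: char_field_aut.
Qed.

(** * First orthogonality for a character and its conjugate, then its product over Irr(G) *)

Lemma sum_aut_irr u i :
  \sum_g u ('chi_i g) * 'chi_i g^-1%g = #|G|%:R *+ (aut_Iirr u i == i).
Proof.
have := cfdot_irr (aut_Iirr u i) i; rewrite cfdotE.
move/(canRL (mulVKf (neq0CG G))).
rewrite mulr_natr => <-; rewrite [RHS]big_mkcond; apply: eq_bigr => g _.
have [Gg|notGg] := ifPn; first by rewrite aut_IirrE cfunE irr_inv.
by rewrite cfun0 ?rmorph0 ?mul0r.
Qed.

(* The indices f take values in the whole type gT: characters vanish off G. *)
Definition irr_prod (f : {ffun Iirr G -> gT}) : algC := \prod_i 'chi_i (f i).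
Definition irr_prodV (f : {ffun Iirr G -> gT}) : algC :=
  \prod_i 'chi_i (f i)^-1%g.

(** By distributivity the sum over f is the product over i of the sums in [sum_aut_irr]; a single
    character moved by u makes it vanish. *)
Lemma sum_aut_irr_prod u :
  \sum_f u (irr_prod f) * irr_prodV f
    = #|G|%:R ^+ #|Iirr G| *+ (irr_action u == irr_action idfun).
Proof.
under eq_bigr do rewrite rmorph_prod -big_split /=.
rewrite -(bigA_distr_bigA (fun i g => u ('chi_i g) * 'chi_i g^-1%g)) /=.
under eq_bigr do rewrite sum_aut_irr.
have id_i i : aut_Iirr idfun i = i.
  by apply: irr_inj; rewrite aut_IirrE; apply/cfunP=> g; rewrite cfunE.
have [/ffunP eq_u|neq_u] := eqVneq.
  rewrite -prodr_const; apply: eq_bigr => i _.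
  by have := eq_u i; rewrite !ffunE id_i => ->; rewrite eqxx.
have [i neq_i] : exists i, aut_Iirr u i != i.
  apply/existsP; apply: contraNT neq_u; rewrite negb_exists => /forallP eq_u.
  by apply/eqP/ffunP=> i; rewrite !ffunE id_i; apply/eqP/negPn/eq_u.
by rewrite (bigD1 i) //= (negPf neq_i) mulr0n mul0r.
Qed.

Lemma char_trace_expand x : x \in char_field G ->
  #|G|%:R ^+ #|Iirr G| * x = \sum_f char_trace (x * irr_prod f) * irr_prodV f.
Proof.
move=> Kx; under eq_bigr do rewrite /char_trace mulr_suml.
rewrite exchange_big /=.
under eq_bigr => s _.
  under eq_bigr do rewrite rmorphM -mulrA.
  rewrite -mulr_sumr sum_aut_irr_prod; over.
rewrite (bigD1 (irr_action idfun)) ?mem_galois_actions //=.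
rewrite galois_liftK ?mem_galois_actions // eqxx mulr1n.
(* The lift of the trivial action need not be [idfun], but agrees with it on K. *)
rewrite (@eq_irr_action (galois_lift _) idfun) //; last first.
  by rewrite galois_liftK ?mem_galois_actions.
rewrite big1 ?addr0 1?mulrC // => s /andP[gal_s neq_s].
by rewrite galois_liftK // (negPf neq_s) mulr0.
Qed.

End CharField.

(** * Traces modulo a power of |G| *)

(** [Zp1] has additive order exactly [n.+1], even in the trivial group ['I_1]. *)
Lemma dvdz_intmul_Zp1 n (z : int) : (Zp1 : 'I_n.+1) *~ z = 0 -> (n.+1 %| z)%Z.
Proof.
have dvd_nat m : (Zp1 : 'I_n.+1) *+ m = 0 -> (n.+1 %| m)%N.
  by rewrite Zp_mulrn => /(congr1 val) /=; rewrite modnMml mul1n => /eqP.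
case: z => m; first exact: dvd_nat.
by rewrite {1}NegzE mulrNz => /eqP; rewrite oppr_eq0 => /eqP /dvd_nat.
Qed.

Theorem theoremA (gT : finGroupType) (G : {group gT}) (p : nat) :
  prime p -> (p %| char_ring_index G)%N -> (p %| #|G|)%N.
Proof.
move=> p_pr p_dvd; set N := (#|G| ^ #|Iirr G|)%N.
have N_gt0 : (0 < N)%N by rewrite expn_gt0 cardG_gt0.
pose F := {ffun Iirr G -> gT}.
have tr_int (x : alg_integers (char_field G)) (f : F) :
    char_trace G (val x * irr_prod f) \in Num.int.
  apply: char_trace_int; rewrite rpredM ?(valP x) // char_ring_integers //.
  by apply: rpred_prod => i _; exact: irr_char_ring.
(* Not 'Z_N, which is Z/2 when N = 1. *)
pose c (x : alg_integers (char_field G)) : 'rV['I_N.-1.+1]_#|F| :=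
  \row_j (Zp1 *~ Num.floor (char_trace G (val x * irr_prod (enum_val j)))).
have c_add : zmod_morphism c.
  move=> x y; apply/rowP=> j; rewrite !mxE -mulrzBr; congr (_ *~ _).
  apply: (@intr_inj algC); rewrite [RHS]mulrzBr.
  rewrite (floorK (tr_int (x - y) _)) (floorK (tr_int x _)).
  by rewrite (floorK (tr_int y _)) /= mulrBl raddfB.
pose cM := GRing.isZmodMorphism.Build _ _ c c_add.
pose cA : {additive _ -> _} := HB.pack c cM.
have ker_c x : cA x = 0 -> x \in char_ring_in_integers (G := G).
  move=> /rowP cx0; rewrite -[_ \in _]/(val x \in char_ring G).
  have N_neq0 : N%:R != 0 :> algC by rewrite pnatr_eq0 -lt0n.
  have /fin_all_exists[q Dq] (f : F) : exists q : int,
      char_trace G (val x * irr_prod f) = N%:R * q%:~R.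
    have := cx0 (enum_rank f); rewrite !mxE enum_rankK.
    move/dvdz_intmul_Zp1/dvdzP => [q Dq]; exists q.
    by rewrite -[LHS]floorK ?tr_int // Dq rmorphM /= mulrC prednK.
  have Kx : val x \in char_field G by have /andP[] := valP x.
  (* Cancelling N in [char_trace_expand] leaves an integer combination of products of character
     values. *)
  have -> : val x = \sum_(f : F) (q f)%:~R * irr_prodV f.
    apply: (mulfI N_neq0); rewrite {1}natrX char_trace_expand // mulr_sumr.
    by apply: eq_bigr => f _; rewrite Dq mulrA.
  apply: rpred_sum => f _; rewrite rpredM ?rpred_int //.
  by apply: rpred_prod => i _; exact: irr_char_ring.
have := dvdn_trans p_dvd (dvdn_card_quot ker_c).
(* The target of c has N ^ #|F| elements, and N is a power of |G|. *)
by rewrite card_mx card_ord prednK // !Euclid_dvdX // => /andP[/andP[]].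
Qed.
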